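(* Let $S$ be a symmetric numerical semigroup with genus $g(S)$, Frobenius number $F(S)$, conductor $c(S)$ and multiplicity $m(S)$. Then $\sigma$ attains its maximum over $S\cap[0,c(S)]$ at some $s \in S$ with $g(S) - \left\lceil \frac{m(S)}{2}\right\rceil \leq s \leq g(S)$. Moreover, if $\sigma$ attains its maximum over $S\cap[0,c(S)]$ at some $s \in S \cap [0, c(S)-1]$, then $\sigma(s) = \sigma(F(S) - s + 1)$.
   Context: A numerical semigroup is a subset $S \subseteq \mathbb{N} = \{0,1,2,\ldots\}$ closed under addition, containing $0$, with finite complement. Its genus is $g(S) := |\mathbb{N}\setminus S|$, Frobenius number $F(S) := \max(\mathbb{N}\setminus S)$, conductor $c(S) := F(S)+1$, multiplicity $m(S) := \min(S\setminus\{0\})$. $S$ is symmetric if $c(S) = 2g(S)$ (equivalently, for every $x \in [0,F(S)]$, $x \in S$ iff $F(S)-x \notin S$). For $s \in S \cap [0,c(S)]$ define $\sigma(s) := \frac{s}{2} - |S \cap [0,s]| + 1$. *)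

(* Defs.v *)
From HB Require Import structures.
From mathcomp Require Import all_boot all_order all_algebra.
From mathcomp Require Import finmap.
From mathcomp Require Import boolp classical_sets functions cardinality.

Set Implicit Arguments.
Unset Strict Implicit.
Unset Printing Implicit Defensive.

Import Order.TTheory GRing.Theory Num.Theory.

Local Open Scope classical_set_scope.
Local Open Scope ring_scope.

Definition numerical_semigroup (S : set nat) : Prop :=
  [/\ S 0%N,
      (forall x y : nat, S x -> S y -> S (x + y)%N)
    & finite_set (~` S)].

Definition genus (S : set nat) : nat := #|` fset_set (~` S)|%fset.

(* The value is an integer because of S = nat, which has no gap: there
   F(S) = -1 by the usual convention, so that c(S) = 0. *)
Definition frobenius (S : set nat) : int :=
  xget (-1) [set F : int | exists2 n : nat, F = n%:Z &
    (~` S) n /\ forall x : nat, (~` S) x -> (x <= n)%N].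

Definition conductor (S : set nat) : int := frobenius S + 1.

(* The default value 0 is never used for a numerical semigroup. *)
Definition multiplicity (S : set nat) : nat :=
  xget 0%N [set m : nat | (S `\ 0%N) m /\
    forall x : nat, (S `\ 0%N) x -> (m <= x)%N].

Definition symmetric_semigroup (S : set nat) : Prop :=
  conductor S = 2 * (genus S)%:Z.

(* Only meaningful for s in S with s <= c(S). *)
Definition sigma (S : set nat) (s : nat) : rat :=
  s%:R / 2 - (#|` fset_set (S `&` [set x | (x <= s)%N])|%fset)%:R + 1.

Definition sigma_domain (S : set nat) : set nat :=
  S `&` [set s | s%:Z <= conductor S].

Definition sigma_max_at (S : set nat) (s : nat) : Prop :=
  sigma_domain S s /\
  forall t : nat, sigma_domain S t -> sigma S t <= sigma S s.

(* Main.v *)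
(** Write [n x] for the number of elements of [S] below [x]; on [S], [sigma] is
    [h x := x / 2 - n x].  Symmetry of [S] gives [h (2 g - x) = h x], and
    [S + m] being contained in [S] makes [h (x + m) - h x] nonincreasing in [x].
    If [2 s + m <= 2 g], then [h (s + m) - h s] is the opposite of the same
    increment at [2 g - s - m >= s], so [h (s + m) >= h s].  A maximizer [s]
    below [g - m / 2] can thus be moved to [s + m], which is strictly closer to
    [g]; and [s |-> 2 g - s] preserves the maximizers. *)
Require Import Defs.
From mathcomp Require Import all_boot all_order all_algebra.
From mathcomp Require Import finmap.
From mathcomp Require Import boolp classical_sets functions cardinality.
From mathcomp Require Import zify lra.

Set Implicit Arguments.
Unset Strict Implicit.
Unset Printing Implicit Defensive.

Import Order.TTheory GRing.Theory Num.Theory.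

Local Open Scope classical_set_scope.
Local Open Scope ring_scope.

Definition count_below (S : set nat) (x : nat) : nat :=
  (\sum_(0 <= i < x) `[< S i >])%N.

Lemma count_belowS (S : set nat) (x : nat) :
  count_below S x.+1 = (count_below S x + `[< S x >])%N.
Proof. by rewrite /count_below big_nat_recr. Qed.

Lemma count_below_setC (S : set nat) (x : nat) :
  (count_below (~` S) x + count_below S x)%N = x.
Proof.
elim: x => [|x IH]; first by rewrite /count_below !big_geq.
by rewrite !count_belowS asbool_neg; case: `[< S x >]; lia.
Qed.

Lemma card_fset_set_below (A : set nat) (x : nat) :
  (forall i, A i -> (i < x)%N) -> #|` fset_set A|%fset = count_below A x.
Proof.
move=> Ax.
have finA : finite_set A.
  by apply: (sub_finite_set _ (finite_II x)) => i; apply: Ax.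
have -> : fset_set A = [fset i in [seq i <- iota 0 x | `[< A i >]]]%fset.
  apply/fsetP => i; rewrite in_fset_set // in_fset mem_filter mem_iota /=.
  rewrite add0n; apply/idP/andP => [/set_mem Ai|[/asboolP /mem_set]//].
  by split; [apply/asboolP | apply: Ax].
rewrite card_fseq undup_id ?filter_uniq ?iota_uniq // size_filter.
by rewrite /count_below -sum1_count big_mkcond /index_iota subn0.
Qed.

(** The element [s] itself lies in [S] and is counted by [sigma]; dropping it absorbs the [+ 1]. *)
Lemma sigma_count_below (S : set nat) (s : nat) : S s ->
  sigma S s = s%:R / 2 - (count_below S s)%:R.
Proof.
move=> Ss; rewrite /sigma (@card_fset_set_below _ s.+1); last by move=> i [_].
have -> : count_below (S `&` [set x | (x <= s)%N]) s.+1 = count_below S s.+1.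
  rewrite /count_below; apply: eq_big_nat => i /andP[_ lt_is].
  by congr (nat_of_bool _); apply: asbool_equiv_eq; split=> [[]|].
by rewrite count_belowS asboolT // addn1 -natr1; lra.
Qed.

Lemma sigma_le (S : set nat) (s t : nat) : S s -> S t ->
  (sigma S t <= sigma S s) =
  (t + 2 * count_below S s <= s + 2 * count_below S t)%N.
Proof.
move=> Ss St; rewrite !sigma_count_below // -(ler_nat rat) !natrD.
by apply/idP/idP => H; lra.
Qed.

Lemma multiplicity_spec (S : set nat) : finite_set (~` S) ->
  S (multiplicity S) /\ (0 < multiplicity S)%N.
Proof.
move=> finS; rewrite /multiplicity; case: xgetP => [m _ [[Sm /eqP m0] _]|none].
  by split=> //; rewrite lt0n.
have ex : exists m, `[< (S `\ 0%N) m >].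
  apply: contrapT => /forallNP noS.
  (* Without a nonzero element of [S], every positive number would be a gap. *)
  apply: infinite_nat; apply: (@sub_finite_set _ _ (~` S `|` [set 0%N])).
    move=> i _; have [->|i0] := eqVneq i 0%N; first by right.
    by left=> Si; apply: (noS i); apply/asboolP; split=> //; apply/eqP.
  by rewrite finite_setU; split.
case: (none (ex_minn ex)); case: ex_minnP => m /asboolP Sm minm.
by split=> // x Sx; apply: minm; apply/asboolP.
Qed.

Lemma conductor_spec (S : set nat) : finite_set (~` S) ->
  exists c : nat, [/\ conductor S = c%:Z,
    forall x, (c <= x)%N -> S x & (0 < c)%N -> ~ S c.-1].
Proof.
move=> finS; rewrite /conductor /frobenius.
case: xgetP => [_ _ [F -> [SF maxF]]|none].
  exists F.+1; split=> //; first by lia.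
  by move=> x lt_Fx; apply: contrapT => /maxF; lia.
(* The default [-1] gives conductor 0, so there must be no gap at all: one gap would yield a largest
   one, by finiteness. *)
exists 0%N; split=> // x _; apply: contrapT => Sx.
have ex : exists i, `[< (~` S) i >] by exists x; apply/asboolP.
have bnd i : `[< (~` S) i >] -> (i <= \max_(j <- fset_set (~` S)) j)%N.
  move=> /asboolP Si; apply: (@leq_bigmax_seq _ _ xpredT id) => //.
  by rewrite in_fset_set // inE.
case: (none (ex_maxn ex bnd)%:Z); exists (ex_maxn ex bnd) => //.
case: ex_maxnP => F /asboolP SF maxF; split=> // i Si.
by apply: maxF; apply/asboolP.
Qed.

Section Symmetric.
Variables (S : set nat) (g : nat).
Hypothesis S0 : S 0%N.
Hypothesis SD : forall x y, S x -> S y -> S (x + y)%N.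
Hypothesis S_ge : forall x, (2 * g <= x)%N -> S x.
Hypothesis S_frob : (0 < g)%N -> ~ S (2 * g).-1.
Hypothesis count_cond : count_below S (2 * g) = g.

Local Notation n := (count_below S).

(** With F = 2g - 1, the numbers x and F - x are not both in [S], since their sum F is a gap. So
    each of the 2g sums over x < 2g is at most 1, while together they count the g elements of [S]
    below 2g twice. Equality in total forces equality in each term. *)
Lemma mem_reflection (x : nat) : (x < 2 * g)%N ->
  (`[< S x >] + `[< S ((2 * g).-1 - x)%N >] = 1)%N.
Proof.
move=> ltx.
have le1 (i : 'I_(2 * g)) : true ->
    (`[< S i >] + `[< S ((2 * g).-1 - i)%N >] <= 1 ?= iff
     (`[< S i >] + `[< S ((2 * g).-1 - i)%N >] == 1))%N.
  move=> _; split=> //; case: asboolP => // Si; case: asboolP => // Sj.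
  case: S_frob; first by case: (i) => /= j; lia.
  by rewrite -(subnK (_ : i <= (2 * g).-1)%N); [apply: SD | case: (i) => /= j; lia].
have [_] := leqif_sum le1.
have -> : (\sum_(i < 2 * g) (`[< S i >] + `[< S ((2 * g).-1 - i) >]) = 2 * g)%N.
  rewrite big_split /= -(big_mkord xpredT (fun i => nat_of_bool `[< S i >])).
  rewrite -(big_mkord xpredT (fun i => nat_of_bool `[< S ((2 * g).-1 - i)%N >])).
  rewrite [X in (_ + X)%N]big_nat_rev /= [X in (_ + X)%N](_ : _ = n (2 * g)).
    by rewrite -/(n _) count_cond; lia.
  apply: eq_big_nat => i /andP[_ lti].
  by congr (nat_of_bool `[< S _ >]); lia.
by rewrite sum1_card card_ord eqxx => /esym/forallP/(_ (Ordinal ltx))/eqP.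
Qed.

(** This is h (2g - x) = h x without fractions. From x to x + 1, the right side gains x if it is in
    [S], and the left side gains 1 but loses F - x if it is in [S]; [mem_reflection] balances the
    two. *)
Lemma count_below_reflection (x : nat) : (x <= 2 * g)%N ->
  (n (2 * g - x) + x = g + n x)%N.
Proof.
elim: x => [|x IH] ltx.
  by rewrite subn0 count_cond /count_below big_geq.
have := IH (ltnW ltx); have := mem_reflection ltx.
have -> : (2 * g - x = ((2 * g).-1 - x).+1)%N by lia.
have -> : (2 * g - x.+1 = (2 * g).-1 - x)%N by lia.
by rewrite !count_belowS; lia.
Qed.

Lemma count_window_le (m x y : nat) : S m -> (x <= y)%N ->
  (n (x + m) + n y <= n (y + m) + n x)%N.
Proof.
move=> Sm /subnK <-; elim: (y - x)%N => [|k IH]; first by rewrite add0n.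
(* Sliding the window by one loses k + x and gains k + x + m, which is in [S] whenever k + x is. *)
rewrite !addSn !count_belowS.
suff : (`[< S (k + x) >] <= `[< S (k + x + m) >])%N by lia.
by case: asboolP => // Sk; rewrite asboolT //; apply: SD.
Qed.

Lemma sigma_shift_le (m s : nat) : S m -> S s -> (2 * s + m <= 2 * g)%N ->
  sigma S s <= sigma S (s + m)%N.
Proof.
move=> Sm Ss le_sm; rewrite sigma_le //; last exact: SD.
have le_s : (s <= 2 * g - (s + m))%N by lia.
have := count_window_le Sm le_s.
have -> : (2 * g - (s + m) + m = 2 * g - s)%N by lia.
(* If the window of length m at s contains w elements of [S], its mirror image contains m - w; hence
   w <= m - w, which is the claim. *)
have := @count_below_reflection s; have := @count_below_reflection (s + m).
by lia.
Qed.

Lemma sigma_reflection (s : nat) : S s -> (s <= 2 * g)%N -> S (2 * g - s)%N ->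
  sigma S (2 * g - s)%N = sigma S s.
Proof.
move=> Ss les Sr; have := count_below_reflection les.
by move=> eq_n; apply/eqP; rewrite eq_le !sigma_le //; lia.
Qed.

Lemma maximizer_reflection_mem (s : nat) :
  S s -> (s <= 2 * g)%N ->
  (forall t, S t -> (t <= 2 * g)%N -> sigma S t <= sigma S s) ->
  S (2 * g - s)%N.
Proof.
case: s => [|s] Ss les maxs; first by rewrite subn0; apply: S_ge.
apply: contrapT => Sr.
have := mem_reflection les.
have -> : ((2 * g).-1 - s = 2 * g - s.+1)%N by lia.
case: asboolP => [Ss'|_]; last by rewrite asboolF.
(* If the mirror image of s + 1 is a gap, then s is in [S], and [sigma] is larger by 1/2 at s than
   at the maximizer s + 1. *)
have /maxs := Ss'; rewrite sigma_le // count_belowS asboolT //.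
by lia.
Qed.

Lemma exists_maximizer : exists s, [/\ S s, (s <= 2 * g)%N &
  forall t, S t -> (t <= 2 * g)%N -> sigma S t <= sigma S s].
Proof.
pose P (i : 'I_(2 * g).+1) := `[< S i >].
have P0 : P ord0 by apply/asboolP.
have [i /asboolP Si maxi] :=
  Order.TotalTheory.arg_maxP (fun i => sigma S (nat_of_ord i)) P0.
exists i; split=> //; first by rewrite -ltnS.
by move=> t St let_; apply: (maxi (Ordinal (_ : t < (2 * g).+1)%N)); apply/asboolP.
Qed.

Lemma exists_central_maximizer (m : nat) : S m -> (0 < m)%N ->
  exists s, [/\ S s, (s <= g)%N, (2 * g <= 2 * s + m)%N &
    forall t, S t -> (t <= 2 * g)%N -> sigma S t <= sigma S s].
Proof.
move=> Sm m_gt0.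
pose P s := `[< [/\ S s, (s <= g)%N &
  forall t, S t -> (t <= 2 * g)%N -> sigma S t <= sigma S s] >].
have fold_max s : S s -> (s <= 2 * g)%N ->
    (forall t, S t -> (t <= 2 * g)%N -> sigma S t <= sigma S s) ->
    P (minn s (2 * g - s)).
  move=> Ss les maxs; apply/asboolP.
  have Sr := maximizer_reflection_mem Ss les maxs.
  have [lesr|ltrs] := leqP s (2 * g - s); first by split=> //; lia.
  split=> //; first by lia.
  by rewrite sigma_reflection.
have exP : exists s, P s.
  by have [s [Ss les maxs]] := exists_maximizer; eexists; apply: fold_max maxs.
have boundP s : P s -> (s <= g)%N by case/asboolP.
(* Take the largest maximizer s up to g. If 2s + m < 2g, then both s + m and its mirror image exceed
   s, so folding s + m back below g contradicts this choice. *)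
case: (ex_maxnP exP boundP) => s /asboolP[Ss les maxs] largest.
exists s; split=> //; rewrite leqNgt; apply/negP => lt_sm.
have shift_max t : S t -> (t <= 2 * g)%N -> sigma S t <= sigma S (s + m)%N.
  move=> St let_; apply: (le_trans (maxs t St let_)).
  by apply: sigma_shift_le => //; lia.
by have /largest := fold_max _ (SD Ss Sm) ltac:(lia) shift_max; lia.
Qed.

End Symmetric.

Theorem theorem2p13 (S : set nat)
    (hS : numerical_semigroup S) (hsym : symmetric_semigroup S) :
  (exists s : nat,
     [/\ sigma_max_at S s,
         (genus S)%:Z - (uphalf (multiplicity S))%:Z <= s%:Z
       & s%:Z <= (genus S)%:Z])
  /\
  (forall s : nat,
     S s -> s%:Z <= conductor S - 1 -> sigma_max_at S s ->
     exists t : nat,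
       [/\ t%:Z = frobenius S - s%:Z + 1,
           sigma_domain S t
         & sigma S s = sigma S t]).
Proof.
have [S0 SD finS] := hS.
have [c [cE S_ge S_frob]] := conductor_spec finS.
have [Sm m_gt0] := multiplicity_spec finS.
move: hsym; rewrite /symmetric_semigroup cE => c2g.
have {c2g} c2g : c = (2 * genus S)%N by lia.
rewrite {}c2g in cE S_ge S_frob.
(* All g gaps lie below the conductor 2g, which leaves g elements of [S] there. *)
have count_cond : count_below S (2 * genus S) = genus S.
  have := count_below_setC S (2 * genus S).
  rewrite -(@card_fset_set_below (~` S)) -/(genus S); first by lia.
  by move=> i Si; rewrite ltnNge; apply/negP => /S_ge.
have {}S_frob : (0 < genus S)%N -> ~ S (2 * genus S).-1.
  by move=> g_gt0; apply: S_frob; lia.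
have domE t : sigma_domain S t <-> S t /\ (t <= 2 * genus S)%N.
  by rewrite /sigma_domain /= cE lez_nat.
have maxE s : sigma_max_at S s <-> [/\ S s, (s <= 2 * genus S)%N &
    forall t, S t -> (t <= 2 * genus S)%N -> sigma S t <= sigma S s].
  split=> [[/domE[Ss les] maxs]|[Ss les maxs]].
    by split=> // t St let_; apply/maxs/domE.
  by split=> [|t /domE[]]; [apply/domE | apply: maxs].
split.
  have [s [Ss les ges maxs]] :=
    exists_central_maximizer S0 SD S_ge S_frob count_cond Sm m_gt0.
  by exists s; split; [apply/maxE; split=> //; lia | lia | lia].
move=> s Ss _ /maxE[_ les maxs].
have Sr := maximizer_reflection_mem SD S_ge S_frob count_cond Ss les maxs.
(* Since F = 2g - 1, this is F - s + 1. *)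
exists (2 * genus S - s)%N; split.
- by move: cE; rewrite /conductor; lia.
- by apply/domE; split=> //; lia.
- by rewrite (sigma_reflection SD S_frob).
Qed.
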